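(* Fix $\vartheta>0$ and let $L_n^{(\vartheta)}$ be the number of leaves in a Hoppe tree with parameter $\vartheta$ and $n\geq 2$ nodes. Then, as $n\to\infty$, \begin{align*} \mathbb{E}[L_n^{(\vartheta)}] &= \frac{n}{2}+ \frac{\vartheta-1}{2} + \mathcal{O}\left( \frac{1}{n} \right),\\ \mathrm{Var}( L_n^{(\vartheta)} ) &= \frac{n}{12}+ \frac{\vartheta-1}{12} + \mathcal{O}\left( \frac{1}{n} \right),\\ \frac{L_n^{(\vartheta)}-\mathbb{E}[L_n^{(\vartheta)}]}{\sqrt{\mathrm{Var}(L_n^{(\vartheta)})}} &\stackrel{d}{\longrightarrow} \mathcal{N}(0,1), \end{align*} and moreover $$\mathbb{P}(|L_n^{(\vartheta)}- \mathbb{E}[L_n^{(\vartheta)}]| \geq t ) \leq 2 \exp\left( - \frac{6 t^2}{n+\vartheta+1} \right) \quad\text{for all } t>0,\ n\ge 1.$$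
   Context: Hoppe tree with parameter $\vartheta>0$: the tree is grown by successive insertion of nodes. Initially there is only the root. In each step a parent node is chosen among the existing nodes, independently of the past, with probability proportional to its weight, where the root has weight $\vartheta$ and every other node has weight $1$; a new node is attached as a child of the chosen node. The Hoppe tree with $n$ nodes is the tree after $n-1$ insertions. A leaf is a node with no children. $\mathcal{N}(0,1)$ is the standard normal distribution. *)

(* Defs.v *)
From HB Require Import structures.
From mathcomp Require Import all_boot all_order all_algebra.
From mathcomp Require Import all_classical all_reals all_analysis.
Set Implicit Arguments. Unset Strict Implicit. Unset Printing Implicit Defensive.
Import Order.TTheory GRing.Theory Num.Theory.
Local Open Scope ring_scope.

(* Hoppe tree with parameter theta.  Nodes are labelled 0 (root), 1, 2, ...
   in insertion order.  A tree with n >= 1 nodes is encoded by its parent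
   sequence s = [:: p_1; ...; p_(n-1)] (0-based list index k holds the parent
   of node k+1), where p_(k+1) \in {0, ..., k}. *)

Fixpoint hoppe_seqs (m : nat) : seq (seq nat) :=
  match m with
  | 0 => [:: [::]]
  | m'.+1 => [seq rcons s j | s <- hoppe_seqs m', j <- iota 0 m'.+1]
  end.

Definition hoppe_weight {R : realType} (theta : R) (j : nat) : R :=
  if j == 0%N then theta else 1.

(* probability of a given parent sequence: when node k+1 is inserted, the
   existing nodes are 0..k with total weight theta + k *)
Definition hoppe_prob {R : realType} (theta : R) (s : seq nat) : R :=
  \prod_(k < size s) (hoppe_weight theta (nth 0%N s k) / (theta + k%:R)).

Definition nleaves (n : nat) (s : seq nat) : nat :=
  count (fun i => i \notin s) (iota 0 n).

Definition leaves_prob {R : realType} (theta : R) (n : nat) (A : pred nat) : R :=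
  \sum_(s <- hoppe_seqs n.-1 | A (nleaves n s)) hoppe_prob theta s.

Definition leaves_mean {R : realType} (theta : R) (n : nat) : R :=
  \sum_(s <- hoppe_seqs n.-1) hoppe_prob theta s * (nleaves n s)%:R.

Definition leaves_var {R : realType} (theta : R) (n : nat) : R :=
  \sum_(s <- hoppe_seqs n.-1)
     hoppe_prob theta s * ((nleaves n s)%:R - leaves_mean theta n) ^+ 2.

(* Main.v *)
(* Given the tree with [n >= 2] nodes and [l] leaves, the next insertion hits a
   leaf with probability [l / (n - 1 + theta)]; in that case [l] is unchanged,
   otherwise it increases by one.  Hence the leaf count is a Markov chain, its
   mean is explicit and its variance satisfies a contracting linear recursion.

   Tail bound: the one-step recursion for the centred count multiplies it by
   [1 - 1 / (n - 1 + theta)] and adds a centred two-point variable of range 1,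
   so Hoeffding's lemma gives by induction
   [E exp (s (L - E L)) <= exp (s^2 (n + theta + 1) / 24)]; conclude by
   Chernoff's method.

   Central limit theorem: [Phi ((c - y) / sqrt w)] solves the heat equation in
   [(w, y)].  Evaluating it along the rescaled martingale, with [w] the variance
   still to come plus [eps^2] times the final variance, each step changes its
   expectation by [O(n^(-3/2))] only.  This yields the limit of
   [E Phi ((x - W_n) / eps)], and letting [eps] tend to 0 recovers the
   distribution function. *)
Require Import Defs.
From HB Require Import structures.
From mathcomp Require Import all_boot all_order all_algebra.
From mathcomp Require Import all_classical all_reals all_analysis.
From mathcomp Require Import ring lra zify.
Set Implicit Arguments.
Unset Strict Implicit.
Unset Printing Implicit Defensive.
Import Order.TTheory GRing.Theory Num.Theory.
Import numFieldNormedType.Exports.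
Local Open Scope classical_set_scope.
Local Open Scope ring_scope.

(** * Mean value and Taylor estimates *)

Lemma deriv_add (R : realType) (f g : R -> R) (x a b : R) :
  is_derive x (1:R) f a -> is_derive x (1:R) g b ->
  is_derive x (1:R) (fun t => f t + g t) (a + b).
Proof. by move=> df dg; exact: is_deriveD. Qed.

Lemma deriv_mul (R : realType) (f g : R -> R) (x a b : R) :
  is_derive x (1:R) f a -> is_derive x (1:R) g b ->
  is_derive x (1:R) (fun t => f t * g t) (a * g x + f x * b).
Proof.
move=> df dg; have := is_deriveM df dg; rewrite -[(f * g)%R]/(fun t => f t * g t) => D; apply: (is_derive_eq D).
by rewrite /GRing.scale/= addrC mulrC.
Qed.

Lemma deriv_scale (R : realType) (f : R -> R) (x a c : R) :
  is_derive x (1:R) f a -> is_derive x (1:R) (fun t => c * f t) (c * a).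
Proof. by move=> df; exact: (@is_deriveZ _ _ _ f c). Qed.

Lemma deriv_cst (R : realType) (x c : R) : is_derive x (1:R) (fun=> c) 0.
Proof. exact: is_derive_cst. Qed.

Lemma deriv_id (R : realType) (x : R) : is_derive x (1:R) (fun t => t) 1.
Proof. exact: is_derive_id. Qed.

Lemma deriv_comp (R : realType) (f g : R -> R) (x a b : R) :
  is_derive (g x) (1:R) f a -> is_derive x (1:R) g b ->
  is_derive x (1:R) (fun t => f (g t)) (a * b).
Proof. exact: is_derive1_comp. Qed.

(** The factor [t] in [[0, 1]] covers both signs of [h], so the Taylor estimates below need no case
    distinction. *)
Lemma mean_value (R : realType) (f f' : R -> R) :
  (forall x, is_derive x (1:R) f (f' x)) ->
  forall a h, exists2 t, 0 <= t <= 1 & f (a + h) - f a = f' (a + t * h) * h.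
Proof.
move=> df a h.
have cf : forall u v, {within `[u, v], continuous f}.
  move=> u v; apply: derivable_within_continuous => x _.
  by have := df x => -[].
have [h0|h0|->] := ltgtP h 0.
- have ah : a + h < a by lra.
  have [c] := MVT ah (fun x _ => df x) (cf _ _).
  rewrite in_itv/= => /andP[c1 c2] E.
  exists ((c - a) / h).
    rewrite ler_ndivlMr // ler_ndivrMr //; apply/andP; split; lra.
  rewrite divfK ?lt_eqF// (_ : a + (c - a) = c); last ring.
  lra.
- have ah : a < a + h by lra.
  have [c] := MVT ah (fun x _ => df x) (cf _ _).
  rewrite in_itv/= => /andP[c1 c2] E.
  exists ((c - a) / h).
    rewrite ler_pdivlMr // ler_pdivrMr //; apply/andP; split; lra.
  rewrite divfK ?gt_eqF// (_ : a + (c - a) = c); last ring.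
  lra.
- exists 0; first by rewrite lexx ler01.
  by rewrite addr0 mulr0 subrr.
Qed.

Lemma taylor2_le (R : realType) (f f1 f2 : R -> R) (M : R) :
  (forall x, is_derive x (1:R) f (f1 x)) -> (forall x, is_derive x (1:R) f1 (f2 x)) ->
  (forall x, `|f2 x| <= M) ->
  forall a h, `|f (a + h) - f a - h * f1 a| <= M * h ^+ 2.
Proof.
move=> d0 d1 b2 a h.
have [t /andP[t0 t1] E] := mean_value d0 a h.
have [u _ E1] := mean_value d1 a (t * h).
have -> : f (a + h) - f a - h * f1 a = t * (f2 (a + u * (t * h)) * h ^+ 2).
  rewrite E; have -> : f1 (a + t * h) = f1 a + f2 (a + u * (t * h)) * (t * h) by rewrite -E1; ring.
  ring.
rewrite 2!normrM (ger0_norm t0) (ger0_norm (sqr_ge0 h)).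
have := b2 (a + u * (t * h)); have := normr_ge0 (f2 (a + u * (t * h))).
have := sqr_ge0 h.
move: (`|_|) => y; move: (h ^+ 2) => z z0 y0 yM.
by rewrite mulrA ler_wpM2r // (le_trans _ yM) // ler_piMl.
Qed.

(** The remainder, as a function of [h], has as its derivative the first-order remainder of [f1],
    which [taylor2_le] bounds. *)
Lemma taylor3_le (R : realType) (f f1 f2 f3 : R -> R) (M : R) :
  (forall x, is_derive x (1:R) f (f1 x)) -> (forall x, is_derive x (1:R) f1 (f2 x)) ->
  (forall x, is_derive x (1:R) f2 (f3 x)) -> (forall x, `|f3 x| <= M) ->
  forall a h, `|f (a + h) - f a - h * f1 a - h ^+ 2 / 2 * f2 a| <= M * `|h| ^+ 3.
Proof.
move=> d0 d1 d2 b3 a h.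
pose g t := f (a + t) - t * f1 a - t ^+ 2 / 2 * f2 a.
pose g1 t := f1 (a + t) - f1 a - t * f2 a.
have dg x : is_derive x (1:R) g (g1 x).
  have da := deriv_add (deriv_cst x a) (deriv_id x).
  have D := deriv_add (deriv_comp (d0 (a + x)) da)
    (deriv_add (deriv_scale (- f1 a) (deriv_id x))
    (deriv_scale (- f2 a / 2)
      (deriv_mul (deriv_id x) (deriv_id x)))).
  rewrite (_ : g = fun t => f (a + t) + (- f1 a * t + - f2 a / 2 * (t * t))).
    by apply: (is_derive_eq D); rewrite /g1; field.
  by apply/funext => t; rewrite /g; field.
have [t /andP[t0 t1] E] := mean_value dg 0 h.
rewrite !add0r in E.
have -> : f (a + h) - f a - h * f1 a - h ^+ 2 / 2 * f2 a = g1 (t * h) * h.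
  by rewrite -E /g addr0; ring.
rewrite normrM exprSr mulrA ler_wpM2r //.
have := taylor2_le d1 d2 b3 a (t * h).
rewrite real_normK ?num_real// => /le_trans; apply.
have M0 : 0 <= M by apply: le_trans (b3 0).
rewrite ler_wpM2l // exprMn ler_piMl ?sqr_ge0// -[leRHS](expr1n _ 2).
by rewrite lerXn2r // nnegrE.
Qed.

(** * Hoeffding's lemma for a two-point distribution *)

Lemma deriv_expM (R : realType) (x c : R) :
  is_derive x (1:R) (fun t => expR (c * t)) (c * expR (c * x)).
Proof.
have D := deriv_comp (is_derive_expR (c * x)) (deriv_scale c (deriv_id x)).
by apply: (is_derive_eq D); ring.
Qed.

(* [h] is the logarithm of the ratio of the two sides; [h] and its derivative
   vanish at [0], and its second derivative is [1 / 4 - q (1 - q)] with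
   [q = p expR x / m x]. *)
Lemma hoeffding_bernoulli (R : realType) (p s : R) : 0 <= p <= 1 ->
  p * expR (s * (1 - p)) + (1 - p) * expR (- (s * p)) <= expR (s ^+ 2 / 8).
Proof.
move=> /andP[p0 p1].
pose m (x : R) := 1 - p + p * expR x.
have m0 x : 0 < m x.
  rewrite /m; have := expR_gt0 x => ex.
  have [->|pn] := eqVneq p 0; first by rewrite mul0r addr0; lra.
  have pp : 0 < p by rewrite lt_neqAle eq_sym pn.
  have := mulr_gt0 pp ex; lra.
pose h x := x ^+ 2 / 8 + p * x - ln (m x).
pose h1 x := x / 4 + p - p * expR x / m x.
pose h2 x := 1 / 4 - p * expR x * (1 - p) / m x ^+ 2.
have dm x : is_derive x (1:R) m (p * expR x).
  rewrite -[p * _]add0r.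
  exact: deriv_add (deriv_cst x (1 - p)) (deriv_scale p (is_derive_expR x)).
have dh x : is_derive x (1:R) h (h1 x).
  have dln := deriv_comp (is_derive1_ln (m0 x)) (dm x).
  have D := deriv_add (deriv_add
    (deriv_scale 8^-1 (deriv_mul (deriv_id x) (deriv_id x)))
    (deriv_scale p (deriv_id x))) (deriv_scale (-1) dln).
  rewrite (_ : h = fun t => 8^-1 * (t * t) + p * t + -1 * ln (m t)).
    by apply: (is_derive_eq D); rewrite /h1; field; rewrite gt_eqF.
  by apply/funext => t; rewrite /h; ring.
have dh1 x : is_derive x (1:R) h1 (h2 x).
  have dV : is_derive x (1:R) (fun t => (m t)^-1) (- (m x) ^- 2 * (p * expR x)).
    have mN0 : m x != 0 by rewrite gt_eqF.
    have [Dm Em] := dm x.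
    by apply: DeriveDef; [exact: derivableV|rewrite deriveV // Em].
  have D := deriv_add (deriv_add (deriv_scale 4^-1 (deriv_id x)) (deriv_cst x p))
    (deriv_mul (deriv_scale (- p) (is_derive_expR x)) dV).
  rewrite (_ : h1 = fun t => 4^-1 * t + p + - p * expR t * (m t)^-1).
    apply: (is_derive_eq D); rewrite /h2 /m; field.
    by rewrite -/(m x) gt_eqF.
  by apply/funext => t; rewrite /h1; ring.
(* The two terms of [m x] have a product of at most a quarter of the square of their sum. *)
have h2_ge0 x : 0 <= h2 x.
  rewrite /h2 subr_ge0 ler_pdivrMr ?exprn_gt0// /m.
  have := sqr_ge0 (1 - p - p * expR x); lra.
have h1_sgn x : 0 <= h1 x * x.
  have [t _] := mean_value dh1 0 x.
  rewrite !add0r => E; have -> : h1 x = h2 (t * x) * x.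
    by rewrite -E /h1 /m expR0 mulr1 subrK mul0r add0r divr1 subrr subr0.
  by rewrite -mulrA -expr2 mulr_ge0 ?sqr_ge0.
have h_ge0 : 0 <= h s.
  have [t /andP[t0 _]] := mean_value dh 0 s.
  rewrite !add0r => E; have -> : h s = h1 (t * s) * s.
    by rewrite -E /h /m expR0 mulr1 subrK ln1; ring.
  have := h1_sgn (t * s); have [->|tn0] := eqVneq t 0.
    by rewrite mul0r => _; rewrite /h1 /m expR0 mulr1 subrK mul0r add0r divr1 subrr mul0r.
  by rewrite mulrCA pmulr_rge0 // lt_neqAle eq_sym tn0.
have -> : p * expR (s * (1 - p)) + (1 - p) * expR (- (s * p))
   = expR (ln (m s) - p * s).
  rewrite expRB lnK ?posrE// mulrBr mulr1 expRB expRN /m [p * s]mulrC; field.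
  by rewrite gt_eqF ?expR_gt0.
by rewrite ler_expR; move: h_ge0; rewrite /h; lra.
Qed.

(** * The standard normal distribution function *)

Definition normal_cdf (R : realType) (x : R) : R :=
  fine (normal_prob 0 1 `]-oo, x]).

Definition std_pdf (R : realType) (x : R) : R := normal_pdf 0 1 x.

Lemma normal_cdfE (R : realType) (x : R) :
  (normal_cdf x)%:E = normal_prob 0 1 `]-oo, x].
Proof. by rewrite fineK // fin_num_measure. Qed.

Lemma std_pdfE (R : realType) (x : R) :
  std_pdf x = normal_peak 1 * expR (- (1/2) * (x * x)).
Proof.
rewrite /std_pdf normal_pdfE ?oner_eq0// /normal_fun; congr (_ * expR _).
by rewrite subr0 expr1n mulr2n; field.
Qed.

Lemma deriv_normal_cdf (R : realType) (x : R) :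
  is_derive x (1:R) (@normal_cdf R) (std_pdf x).
Proof.
(* The fundamental theorem of calculus is applied on a half-line that ends beyond [x]; the end
   [x + 1] is arbitrary. *)
have xu : x < x + 1 by rewrite ltrDl.
have int : (lebesgue_measure : measure _ R).-integrable
    [set` Interval -oo%O (BRight (x + 1))] (EFin \o normal_pdf 0 1).
  exact: (integrableS _ _ _ (integrable_normal_pdf 0 1)).
have cont : {for x, continuous (@normal_pdf R 0 1)}.
  by apply: continuous_normal_pdf; exact: oner_neq0.
have [d e] := continuous_FTC1 xu int (ltNyr _) cont.
by rewrite derive1E in e; apply: DeriveDef.
Qed.

Lemma deriv_std_pdf (R : realType) (x : R) :
  is_derive x (1:R) (@std_pdf R) (- x * std_pdf x).
Proof.
have D := deriv_scale (normal_peak 1) (deriv_comp (is_derive_expR _)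
  (deriv_scale (- (1/2)) (deriv_mul (deriv_id x) (deriv_id x)))).
rewrite (_ : @std_pdf R = fun t => normal_peak 1 * expR (- (1/2) * (t * t))).
  by apply: (is_derive_eq D); field.
by apply/funext => t; rewrite std_pdfE.
Qed.

Lemma deriv_mul_std_pdf (R : realType) (x : R) :
  is_derive x (1:R) (fun t : R => - t * std_pdf t) ((x ^+ 2 - 1) * std_pdf x).
Proof.
have D := deriv_scale (-1) (deriv_mul (deriv_id x) (deriv_std_pdf x)).
rewrite (_ : (fun t : R => - t * std_pdf t) = fun t => -1 * (t * std_pdf t)).
  by apply: (is_derive_eq D); ring.
by apply/funext => t; ring.
Qed.

(** * Bounds for polynomial multiples of the normal density *)

Lemma std_pdf_ge0 (R : realType) (x : R) : 0 <= std_pdf x.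
Proof. exact: normal_pdf_ge0. Qed.

Lemma normal_peak1_le1 (R : realType) : normal_peak 1 <= 1 :> R.
Proof.
rewrite /normal_peak invf_le1.
  rewrite -[leLHS]sqrtr1 ler_sqrt expr1n mul1r ?mulr2n.
    by have := pi_ge2 R; lra.
  by have := pi_ge2 R; lra.
by rewrite sqrtr_gt0 expr1n mul1r mulr2n; have := pi_ge2 R; lra.
Qed.

(** The quadratic term of the exponential series at [x ^+ 2 / 2] is [x ^+ 4 / 8]: enough decay to
    absorb polynomials of degree at most 4. *)
Lemma std_pdf_quartic (R : realType) (x : R) : std_pdf x * (8 + x ^+ 4) <= 8.
Proof.
have e : 1 + x ^+ 4 / 8 <= expR (1/2 * (x * x)).
  have h : 0 <= 1/2 * (x * x) by rewrite mulr_ge0 // -expr2 sqr_ge0.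
  apply: le_trans (expR_ge1Dxn 1 h); rewrite (_ : 2`! = 2)%N // lerD2l.
  lra.
have p0 : 0 <= normal_peak 1 :> R := normal_peak_ge0 1.
have p1 := normal_peak1_le1 R.
rewrite std_pdfE mulNr expRN; have := expR_gt0 (1/2 * (x * x)).
move: (expR _) e => E e E0; rewrite -mulrA.
apply: (@le_trans _ _ (1 * (E^-1 * (8 + x ^+ 4)))).
  rewrite ler_wpM2r // mulr_ge0 ?invr_ge0 ?ltW//.
  by have := sqr_ge0 (x ^+ 2); rewrite -exprM /= => ?; lra.
by rewrite mul1r ler_pdivrMl //; lra.
Qed.

Lemma std_pdf_poly_le (R : realType) (x y : R) : `|y| <= 2 * (8 + x ^+ 4) ->
  `|y * std_pdf x| <= 16.
Proof.
move=> yx; rewrite normrM (ger0_norm (std_pdf_ge0 x)).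
apply: le_trans (ler_wpM2r (std_pdf_ge0 x) yx) _.
have := std_pdf_quartic x; lra.
Qed.

Lemma std_pdf_linear_le (R : realType) (x : R) : `|x * std_pdf x| <= 16.
Proof.
apply: std_pdf_poly_le; rewrite ler_norml; apply/andP.
have := sqr_ge0 (x ^+ 2 - 1); have := sqr_ge0 (x - 1); have := sqr_ge0 (x + 1).
by split; lra.
Qed.

Lemma std_pdf_quadratic_le (R : realType) (x : R) : `|(x ^+ 2 - 1) * std_pdf x| <= 16.
Proof.
apply: std_pdf_poly_le; rewrite ler_norml; apply/andP.
have := sqr_ge0 (x ^+ 2 - 1); have := sqr_ge0 x.
by split; lra.
Qed.

Lemma std_pdf_cubic_le (R : realType) (x : R) : `|(x ^+ 3 - x) * std_pdf x| <= 16.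
Proof.
apply: std_pdf_poly_le; rewrite ler_norml; apply/andP.
have := sqr_ge0 (x ^+ 2 - x); have := sqr_ge0 (x ^+ 2 + x).
have := sqr_ge0 (x ^+ 2 - 1); have := sqr_ge0 (x - 1); have := sqr_ge0 (x + 1).
by split; lra.
Qed.

(** * Expansions of the normal distribution function in space and in time *)

Lemma normal_cdf_taylor (R : realType) (z h : R) :
  `|normal_cdf (z + h) - normal_cdf z - h * std_pdf z + h ^+ 2 / 2 * (z * std_pdf z)|
    <= 16 * `|h| ^+ 3.
Proof.
have := taylor3_le (@deriv_normal_cdf R) (@deriv_std_pdf R) (@deriv_mul_std_pdf R)
  (@std_pdf_quadratic_le R) z h.
by rewrite mulNr mulrN opprK.
Qed.

(** Along [y = z * expR (- u)] the derivative in [u] is [- y * std_pdf y], which is also the second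
    derivative of [normal_cdf] at [y]: the heat equation in logarithmic time. *)
Lemma normal_cdf_heat (R : realType) (z u : R) :
  `|normal_cdf (z * expR (- u)) - normal_cdf z + u * (z * std_pdf z)| <= 16 * u ^+ 2.
Proof.
pose y t : R := z * expR (- 1 * t).
have dy x : is_derive x (1:R) y (- y x).
  apply: (is_derive_eq (deriv_scale z (deriv_expM x (-1)))).
  by rewrite /y; ring.
have d1 x : is_derive x (1:R) (fun t => normal_cdf (y t)) (- y x * std_pdf (y x)).
  by apply: (is_derive_eq (deriv_comp (deriv_normal_cdf _) (dy x))); ring.
have d2 x : is_derive x (1:R) (fun t => - y t * std_pdf (y t))
    (- ((y x ^+ 3 - y x) * std_pdf (y x))).
  apply: (is_derive_eq (deriv_comp (deriv_mul_std_pdf (y x)) (dy x))); ring.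
have b2 x : `|- ((y x ^+ 3 - y x) * std_pdf (y x))| <= 16.
  by rewrite normrN std_pdf_cubic_le.
have := taylor2_le d1 d2 b2 0 u.
by rewrite /y mulr0 expR0 mulr1 add0r !mulN1r mulNr mulrN opprK.
Qed.

(** Put [1 + tau = expR (2 * u)] in [normal_cdf_heat]; then [u] is [tau / 2] up to
    [tau ^+ 2 / 2]. *)
Lemma normal_cdf_time (R : realType) (z tau : R) : 0 <= tau ->
  `|normal_cdf (z / Num.sqrt (1 + tau)) - normal_cdf z + tau / 2 * (z * std_pdf z)|
    <= 16 * tau ^+ 2.
Proof.
move=> tau0; have t1 : 0 < 1 + tau by lra.
pose u : R := ln (1 + tau) / 2.
have eu : Num.sqrt (1 + tau) = expR u.
  rewrite -[1 + tau](@lnK R) ?posrE// -/u; have -> : ln (1 + tau) = u + u by rewrite /u; field.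
  by rewrite expRD -expr2 sqrtr_sqr ger0_norm ?expR_ge0.
have u1 : u <= tau / 2 by rewrite /u ler_pM2r ?invr_gt0// le_ln1Dx//; lra.
(* The lower bound on the logarithm is the upper bound [ln y <= y - 1] at the inverse of
   [1 + tau]. *)
have u2 : tau / 2 - tau ^+ 2 / 2 <= u.
  have i0 : 0 < (1 + tau)^-1 by rewrite invr_gt0.
  have : ln (1 + ((1 + tau)^-1 - 1)) <= (1 + tau)^-1 - 1 by rewrite le_ln1Dx//; lra.
  rewrite addrC subrK lnV ?posrE// => L.
  have : (1 + tau)^-1 <= 1 - tau + tau ^+ 2.
    rewrite -[leLHS]mul1r ler_pdivrMr //.
    have : 0 <= tau ^+ 3 by rewrite exprn_ge0.
    lra.
  rewrite /u; lra.
have u0 : 0 <= u by rewrite /u divr_ge0 // ln_ge0; lra.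
have uu : u ^+ 2 <= tau ^+ 2 / 4.
  have : u ^+ 2 <= (tau / 2) ^+ 2 by rewrite lerXn2r // nnegrE; lra.
  lra.
rewrite eu -expRN.
have H := normal_cdf_heat z u; have X := std_pdf_linear_le z.
set a := normal_cdf _ - _ in H *.
have -> : a + tau / 2 * (z * std_pdf z) =
  (a + u * (z * std_pdf z)) + (tau / 2 - u) * (z * std_pdf z) by ring.
apply: le_trans (ler_normD _ _) _; rewrite normrM.
have Y : `|tau / 2 - u| <= tau ^+ 2 / 2 by rewrite ler_norml; apply/andP; split; lra.
have := ler_pM (normr_ge0 _) (normr_ge0 _) Y X.
lra.
Qed.

(** A centred two-point step of variance [b ^+ 2 * (p * (1 - p))] is compared with a time change by
    [b ^+ 2 * q]. Later [q] is an averaged variance, and the last error term is the price of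
    averaging. *)
Lemma normal_cdf_step (R : realType) (p b q z : R) :
  0 <= p <= 1 -> 0 <= b -> 0 <= q <= 1 ->
  `|p * normal_cdf (z + b * (1 - p)) + (1 - p) * normal_cdf (z - b * p)
    - normal_cdf (z / Num.sqrt (1 + b ^+ 2 * q))|
  <= 16 * (b ^+ 3 + b ^+ 4) + 8 * (b ^+ 2 * `|p * (1 - p) - q|).
Proof.
move=> /andP[p0 p1] b0 /andP[q0 q1].
have p1' : 0 <= 1 - p by lra.
have tau0 : 0 <= b ^+ 2 * q by rewrite mulr_ge0 ?sqr_ge0.
have H1 := normal_cdf_taylor z (b * (1 - p)).
have H2 := normal_cdf_taylor z (- (b * p)).
have H3 := normal_cdf_time z tau0.
have X := std_pdf_linear_le z.
set F := @normal_cdf R in H1 H2 H3 *.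
set A1 := F (z + _) in H1 *; set A2 := F (z - _) in H2 *; set A3 := F (z / _) in H3 *.
have cube t : 0 <= t <= 1 -> `|b * t| ^+ 3 <= b ^+ 3.
  move=> /andP[t0 t1]; rewrite ger0_norm ?mulr_ge0//.
  by rewrite lerXn2r ?nnegrE ?mulr_ge0// ler_piMr.
have c1 : `|b * (1 - p)| ^+ 3 <= b ^+ 3 by apply: cube; lra.
have c2 : `|- (b * p)| ^+ 3 <= b ^+ 3 by rewrite normrN; apply: cube; lra.
have tq : (b ^+ 2 * q) ^+ 2 <= b ^+ 4.
  have -> : b ^+ 4 = (b ^+ 2) ^+ 2 by ring.
  by rewrite lerXn2r ?nnegrE ?sqr_ge0// ler_piMr ?sqr_ge0.
set R1 := A1 - _ - _ + _ in H1; set R2 := A2 - _ - _ + _ in H2; set R3 := A3 - _ + _ in H3.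
(* First-order terms cancel because the step is centred; second-order terms leave the difference of
   the variances. *)
have -> : p * A1 + (1 - p) * A2 - A3 =
  p * R1 + (1 - p) * R2 - R3 - b ^+ 2 / 2 * (p * (1 - p) - q) * (z * std_pdf z).
  by rewrite /R1 /R2 /R3; field.
apply: le_trans (ler_normB _ _) _.
apply: le_trans (lerD (ler_normB _ _) (lexx _)) _.
apply: le_trans (lerD (lerD (ler_normD _ _) (lexx _)) (lexx _)) _.
have b2 : 0 <= b ^+ 2 / 2 by rewrite divr_ge0 ?sqr_ge0.
rewrite !(normrM p) (normrM (1 - p)) (ger0_norm p0) (ger0_norm p1').
rewrite (normrM _ (z * std_pdf z)) (normrM (b ^+ 2 / 2)) (ger0_norm b2).
have h1 : p * `|R1| <= p * (16 * b ^+ 3).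
  by rewrite ler_wpM2l // (le_trans H1)// ler_wpM2l.
have h2 : (1 - p) * `|R2| <= (1 - p) * (16 * b ^+ 3).
  by rewrite ler_wpM2l // (le_trans H2)// ler_wpM2l.
have h3 := ler_wpM2l (mulr_ge0 b2 (normr_ge0 (p * (1 - p) - q))) X.
lra.
Qed.

(** * Monotonicity, Lipschitz bound and tails of the normal distribution function *)

Lemma normal_cdf_ge0 (R : realType) (x : R) : 0 <= normal_cdf x.
Proof. by rewrite fine_ge0. Qed.

Lemma normal_cdf_le1 (R : realType) (x : R) : normal_cdf x <= 1.
Proof. by rewrite -lee_fin normal_cdfE probability_le1. Qed.

Lemma normal_cdf_le (R : realType) (x y : R) : x <= y ->
  normal_cdf x <= normal_cdf y.
Proof.
move=> xy; rewrite -lee_fin !normal_cdfE le_measure ?inE //.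
by apply: subset_itvl; rewrite bnd_simp.
Qed.

Lemma normal_cdf_lip (R : realType) (x y : R) :
  `|normal_cdf y - normal_cdf x| <= `|y - x|.
Proof.
have [t _] := mean_value (@deriv_normal_cdf R) x (y - x).
rewrite [x + _]addrC subrK => ->.
rewrite normrM ger0_norm ?std_pdf_ge0 // ler_piMl //.
rewrite (le_trans _ (normal_peak1_le1 R)) // std_pdfE ler_piMr ?normal_peak_ge0 //.
by rewrite expR_le1 mulNr oppr_le0 mulr_ge0 // -expr2 sqr_ge0.
Qed.

(** The identity as a random variable: under [normal_prob 0 1] its distribution function is
    [normal_cdf], so general limits at infinity apply. *)
Definition id_measurableR (R : realType) : measurableTypeR R -> R := idfun.

HB.instance Definition _ (R : realType) :=
  @isMeasurableFun.Build _ _ _ _ (@id_measurableR R) (@measurable_id _ _ setT).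

Lemma normal_cdf_tails (R : realType) (e : R) : 0 < e ->
  exists2 M : R, 0 <= M & normal_cdf (- M) <= e /\ 1 - e <= normal_cdf M.
Proof.
move=> e0.
pose X : {RV (normal_prob (0 : R) 1) >-> R} := @id_measurableR R.
have /fine_cvgP[_ /cvgrPdist_le /(_ e e0)] := cvg_cdfNy0 X.
move=> [a [_ Ha]].
have /fine_cvgP[_ /cvgrPdist_le /(_ e e0)] := cvg_cdfy1 X.
move=> [b [_ Hb]].
pose M := Num.max 0 (Num.max (1 - a) (b + 1)).
have M0 : 0 <= M by rewrite le_max lexx.
have Ma : - M < a by rewrite ltrNl; apply: (@lt_le_trans _ _ (1 - a)); rewrite ?ltrDr // le_max le_max lexx orbT.
have Mb : b < M by apply: (@lt_le_trans _ _ (b + 1)); rewrite ?ltrDl // !le_max lexx !orbT.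
exists M => //; split.
  have : `|0 - normal_cdf (- M)| <= e by exact: (Ha _ Ma).
  by rewrite sub0r normrN ger0_norm // normal_cdf_ge0.
have : `|1 - normal_cdf M| <= e by exact: (Hb _ Mb).
rewrite ler_norml => /andP[_]; lra.
Qed.

(** * The leaf count as a Markov chain *)

(** Mean and variance are instances by unfolding, and [leaves_prob] is one by [leaves_probE], so one
    recursion serves all three. *)
Definition leaves_E (R : realType) (theta : R) (n : nat) (f : nat -> R) : R :=
  \sum_(s <- hoppe_seqs n.-1) hoppe_prob theta s * f (nleaves n s).

(** The last clause says that the root is no leaf from two nodes on: the first insertion has no
    other parent to choose. *)
Lemma hoppe_seqsP (m : nat) (s : seq nat) : s \in hoppe_seqs m ->
  [/\ size s = m, all (fun i => i < m)%N s & (0 < m)%N -> 0%N \in s].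
Proof.
elim: m s => [|m IH] s.
  by rewrite /= inE => /eqP ->.
rewrite -[hoppe_seqs m.+1]/[seq rcons s j | s <- hoppe_seqs m, j <- iota 0 m.+1].
case/allpairsP => -[t j] [/IH[st at_ zt]].
rewrite mem_iota /= add0n => jm ->.
split.
- by rewrite size_rcons st.
- rewrite all_rcons /= jm /=; apply: sub_all at_ => i; lia.
- move=> _; rewrite mem_rcons inE.
  case: m zt jm {IH st at_} => [|m] zt jm.
    by rewrite (_ : j = 0)%N //; lia.
  by rewrite zt ?orbT.
Qed.

Lemma hoppe_prob_rcons (R : realType) (theta : R) s j :
  hoppe_prob theta (rcons s j) =
  hoppe_prob theta s * (hoppe_weight theta j / (theta + (size s)%:R)).
Proof.
rewrite /hoppe_prob size_rcons big_ord_recr /= nth_rcons ltnn eqxx.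
by congr (_ * _); apply: eq_bigr => i _; rewrite nth_rcons ltn_ord.
Qed.

(** The new node is a leaf, and its parent stops being one if it had no child before. *)
Lemma nleaves_rcons n s j : all (fun i => i < n)%N s -> (j < n)%N ->
  nleaves n.+1 (rcons s j) = (if j \in s then (nleaves n s).+1 else nleaves n s).
Proof.
move=> /allP sn jn; rewrite /nleaves -addn1 iotaD count_cat /= add0n addn0.
rewrite mem_rcons inE.
have /negbTE -> : n \notin s by apply/negP => /sn; rewrite ltnn.
rewrite gtn_eqF //= addn1.
case: ifPn => js.
  congr _.+1; apply: eq_count => i; rewrite /= mem_rcons inE negb_or andbC.
  by case: eqVneq => [->|_] /=; rewrite ?js ?andbT.
rewrite -!sum1_count [RHS](big_rem j) ?mem_iota //= js add1n.
rewrite rem_filter ?iota_uniq // big_filter_cond.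
by congr _.+1; apply: eq_bigl => i; rewrite mem_rcons inE negb_or.
Qed.

Lemma nleaves_le n s : (0 < n)%N -> 0%N \in s -> (nleaves n s <= n.-1)%N.
Proof.
case: n => // n _ s0; rewrite /nleaves /= s0 add0n.
by rewrite (leq_trans (count_size _ _)) // size_iota.
Qed.

Section Expectation.
Variables (R : realType) (theta : R).
Hypothesis theta_gt0 : 0 < theta.

Lemma hoppe_prob_ge0 s : 0 <= hoppe_prob theta s.
Proof.
apply: prodr_ge0 => i _; apply: divr_ge0; last by rewrite addr_ge0 // ltW.
by rewrite /hoppe_weight; case: ifP => // _; exact: ltW.
Qed.

Lemma leaves_E_le n f g : (1 < n)%N ->
  (forall l, (l <= n.-1)%N -> f l <= g l) ->
  leaves_E theta n f <= leaves_E theta n g.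
Proof.
move=> n1 fg; rewrite /leaves_E big_seq [leRHS]big_seq; apply: ler_sum => s sn.
rewrite ler_wpM2l ?hoppe_prob_ge0// fg // nleaves_le //; first lia.
by have [_ _] := hoppe_seqsP sn; apply; lia.
Qed.

Lemma eq_leaves_E n f g : (1 < n)%N ->
  (forall l, (l <= n.-1)%N -> f l = g l) ->
  leaves_E theta n f = leaves_E theta n g.
Proof.
by move=> n1 fg; apply/eqP; rewrite eq_le !leaves_E_le // => l ln; rewrite fg.
Qed.

Lemma leaves_ED n f g :
  leaves_E theta n (fun l => f l + g l) = leaves_E theta n f + leaves_E theta n g.
Proof. by rewrite /leaves_E -big_split; apply: eq_bigr => s _; rewrite mulrDr. Qed.

Lemma leaves_EZ n (c : R) f :
  leaves_E theta n (fun l => c * f l) = c * leaves_E theta n f.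
Proof. by rewrite /leaves_E mulr_sumr; apply: eq_bigr => s _; rewrite mulrCA. Qed.

Lemma leaves_E2 f : leaves_E theta 2 f = f 1%N.
Proof.
rewrite /leaves_E /= big_seq1 /hoppe_prob big_ord_recl big_ord0 /hoppe_weight /=.
by rewrite !mulr1 addr0 divff ?gt_eqF// mul1r.
Qed.

Lemma leaves_E1 f : leaves_E theta 1 f = f 1%N.
Proof. by rewrite /leaves_E /= big_seq1 /hoppe_prob big_ord0 mul1r. Qed.

Lemma sum_hoppe_weight n :
  \sum_(j <- iota 0 n.+1) hoppe_weight theta j = theta + n%:R.
Proof.
elim: n => [|n IH]; first by rewrite big_seq1 addr0.
by rewrite -[n.+2]addn1 iotaD big_cat big_seq1 /= IH add0n -addrA natr1.
Qed.

(** All leaves have weight 1, since the root has a child; hence their total weight is their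
    number. *)
Lemma sum_hoppe_weight_leaves n s (f : nat -> R) : 0%N \in s ->
  \sum_(j <- iota 0 n.+1) hoppe_weight theta j *
      f (if j \in s then (nleaves n.+1 s).+1 else nleaves n.+1 s) =
  (nleaves n.+1 s)%:R * f (nleaves n.+1 s) +
  (theta + n%:R - (nleaves n.+1 s)%:R) * f (nleaves n.+1 s).+1.
Proof.
move=> s0; set l := nleaves n.+1 s.
have -> : l%:R = \sum_(j <- iota 0 n.+1) (j \notin s)%:R :> R.
  rewrite /l /nleaves -sum1_count natr_sum big_mkcond /=.
  by apply: eq_bigr => j _; case: (j \in s).
rewrite -sum_hoppe_weight -sumrB !mulr_suml -big_split; apply: eq_bigr => j _ /=.
rewrite /hoppe_weight; have [js|js] := boolP (j \in s) => /=.
  by rewrite mul0r add0r subr0.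
have -> : (j == 0%N) = false by apply: contraNF js => /eqP ->.
by rewrite subrr mul0r addr0.
Qed.

Lemma leaves_ES n f : (1 < n)%N ->
  leaves_E theta n.+1 f =
  leaves_E theta n (fun l => l%:R / (n.-1%:R + theta) * f l
    + (1 - l%:R / (n.-1%:R + theta)) * f l.+1).
Proof.
case: n => [//|n] n1; rewrite /leaves_E -[n.+2.-1]/n.+1 -[n.+1.-1]/n.
rewrite -[hoppe_seqs n.+1]/[seq rcons s j | s <- hoppe_seqs n, j <- iota 0 n.+1].
rewrite big_allpairs_dep big_seq [RHS]big_seq; apply: eq_bigr => s sn.
have [ss sa s0] := hoppe_seqsP sn.
have N0 : n%:R + theta != 0 by rewrite gt_eqF // ltr_wpDl.
transitivity (hoppe_prob theta s / (n%:R + theta) *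
  \sum_(j <- iota 0 n.+1) hoppe_weight theta j *
      f (if j \in s then (nleaves n.+1 s).+1 else nleaves n.+1 s)).
  rewrite mulr_sumr big_seq [RHS]big_seq; apply: eq_bigr => j.
  rewrite mem_iota add0n /= => jn; rewrite hoppe_prob_rcons ss nleaves_rcons //.
    by rewrite [theta + _]addrC; field.
  by apply: sub_all sa => i; lia.
rewrite sum_hoppe_weight_leaves; last by apply: s0; lia.
by field.
Qed.

End Expectation.

(** * Mean, variance and tail of the leaf count *)

Section Moments.
Variables (R : realType) (theta : R).
Hypothesis theta_gt0 : 0 < theta.

Local Notation E := (leaves_E theta).
Local Notation mean := (leaves_mean theta).
Local Notation var := (leaves_var theta).

Definition total_weight (n : nat) : R := n.-1%:R + theta.
Local Notation W := total_weight.

Lemma total_weightS n : (0 < n)%N -> W n.+1 = W n + 1.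
Proof. by case: n => // n _; rewrite /W /= -natr1 addrAC. Qed.

Lemma total_weight_gt1 n : (1 < n)%N -> 1 < W n.
Proof.
case: n => [|[|n]] // _; rewrite /W /= -natr1.
have := ler0n R n; have := theta_gt0; lra.
Qed.

Lemma leaf_prob_itv n l : (1 < n)%N -> (l <= n.-1)%N -> 0 <= l%:R / W n <= 1.
Proof.
move=> n1 ln; have W1 := total_weight_gt1 n1.
have W0 : 0 < W n by lra.
apply/andP; split; first by rewrite divr_ge0 // ltW.
rewrite ler_pdivrMr // mul1r /W.
have : l%:R <= n.-1%:R :> R by rewrite ler_nat.
have := theta_gt0; lra.
Qed.

Lemma leaves_E_cst n (c : R) : (0 < n)%N -> E n (fun=> c) = c.
Proof.
case: n => [//|[|n]] _; first exact: leaves_E1.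
elim: n => [|n IH]; first exact: leaves_E2.
rewrite leaves_ES // -[RHS]IH; apply: eq_leaves_E => // l _; ring.
Qed.

Lemma leaves_E_affine n (a c : R) f : (0 < n)%N ->
  E n (fun l => a * f l + c) = a * E n f + c.
Proof. by move=> n0; rewrite leaves_ED leaves_EZ leaves_E_cst. Qed.

Lemma leaves_mean_affine n (a c : R) : (0 < n)%N ->
  E n (fun l => a * l%:R + c) = a * mean n + c.
Proof. exact: leaves_E_affine. Qed.

Lemma leaves_meanS n : (1 < n)%N -> mean n.+1 = (1 - (W n)^-1) * mean n + 1.
Proof.
move=> n1; rewrite -leaves_mean_affine //; last lia.
rewrite [mean n.+1](leaves_ES theta_gt0 _ n1); apply: eq_leaves_E => // l _.
by rewrite -/(W n) -natr1; ring.
Qed.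

Lemma leaves_mean2 : mean 2 = 1.
Proof. exact: leaves_E2. Qed.

Lemma leaves_var2 : var 2 = 0.
Proof.
have -> : var 2 = (1 - mean 2) ^+ 2.
  exact: (leaves_E2 theta_gt0 (fun l => (l%:R - mean 2) ^+ 2)).
by rewrite leaves_mean2 subrr expr0n.
Qed.

(** [W n / 2] is a particular solution of the recursion, multiples of [(W n - 1)^-1] solve the
    homogeneous one, and [mean 2 = 1] fixes the factor. *)
Lemma leaves_meanE n : (1 < n)%N ->
  mean n = W n / 2 + (1 - theta) * theta / 2 / (W n - 1).
Proof.
case: n => [|[|n]] // _; elim: n => [|n IH].
  rewrite leaves_mean2 /W /= addrAC subrr add0r.
  by field; rewrite gt_eqF.
rewrite leaves_meanS // IH !(@total_weightS n.+2) //.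
have := @total_weight_gt1 n.+2 isT; move: (W _) => w w1; field.
by apply/andP; split; rewrite gt_eqF //; lra.
Qed.

(** Given [l], the added step is [- (1 - p)] with probability [p] and [p] with probability [1 - p],
    hence centred and of range 1. *)
Lemma leaves_ES_centered n (g : R -> R) : (1 < n)%N ->
  E n.+1 (fun l => g (l%:R - mean n.+1)) =
  E n (fun l => let p := l%:R / W n in
    p * g ((1 - (W n)^-1) * (l%:R - mean n) - (1 - p)) +
    (1 - p) * g ((1 - (W n)^-1) * (l%:R - mean n) + p)).
Proof.
move=> n1; rewrite leaves_ES // leaves_meanS //; apply: eq_leaves_E => // l _ /=.
rewrite -/(W n) -natr1; congr (_ * g _ + _ * g _); ring.
Qed.

(** Expected conditional variance of one insertion step. *)
Definition branch_var n : R :=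
  E n (fun l => l%:R / W n * (1 - l%:R / W n)).

(** The cross term vanishes because the step is centred given [l]. *)
Lemma leaves_varS n : (1 < n)%N ->
  var n.+1 = (1 - (W n)^-1) ^+ 2 * var n + branch_var n.
Proof.
move=> n1; rewrite [var n.+1](leaves_ES_centered (fun x => x ^+ 2)) //.
rewrite -[var n]/(E n (fun l => (l%:R - mean n) ^+ 2)) /branch_var.
by rewrite -leaves_EZ -leaves_ED; apply: eq_leaves_E => // l _ /=; ring.
Qed.

(** Bias-variance decomposition; by [leaves_meanE] the squared term is the bias of the mean relative
    to [W n / 2]. *)
Lemma leaves_E_leaf_prob_sqr n : (1 < n)%N ->
  E n (fun l => (l%:R / W n - 1 / 2) ^+ 2) =
  (var n + ((1 - theta) * theta / 2 / (W n - 1)) ^+ 2) / W n ^+ 2.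
Proof.
move=> n1; have W1 := total_weight_gt1 n1.
set d := (1 - theta) * theta / 2 / (W n - 1).
transitivity (E n (fun l => (W n) ^- 2 * (l%:R - mean n) ^+ 2 +
    (2 * d / W n ^+ 2 * l%:R + (d ^+ 2 - 2 * d * mean n) / W n ^+ 2))).
  apply: eq_leaves_E => // l _; rewrite leaves_meanE // -/d.
  have := W1; move: (W n) (l%:R) d => w x d w1; field.
  by rewrite gt_eqF //; lra.
rewrite leaves_ED leaves_EZ leaves_mean_affine; last lia.
rewrite -[E n _]/(var n); move: (W n) (mean n) (var n) d W1 => w m v d w1; field.
by rewrite gt_eqF //; lra.
Qed.

Lemma branch_varE n : (1 < n)%N ->
  branch_var n = 1 / 4 - E n (fun l => (l%:R / W n - 1 / 2) ^+ 2).
Proof.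
move=> n1; rewrite -mulN1r -leaves_EZ -(@leaves_E_cst n (1/4)); last lia.
by rewrite -leaves_ED; apply: eq_leaves_E => // l _; field; rewrite gt_eqF //;
  have := total_weight_gt1 n1; lra.
Qed.

Lemma leaves_var_ge0 n : 0 <= var n.
Proof. by apply: sumr_ge0 => s _; rewrite mulr_ge0 ?hoppe_prob_ge0 ?sqr_ge0. Qed.

Lemma branch_var_itv n : (1 < n)%N -> 0 <= branch_var n <= 1 / 4.
Proof.
move=> n1; apply/andP; split.
  rewrite -[leLHS](@leaves_E_cst n 0); last lia.
  apply: leaves_E_le => // l /(leaf_prob_itv n1) /andP[p0 p1].
  by rewrite mulr_ge0 // subr_ge0.
rewrite branch_varE // lerBlDr lerDl -[leLHS](@leaves_E_cst n 0); last lia.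
by apply: leaves_E_le => // l _; exact: sqr_ge0.
Qed.

(** Each insertion adds at most 1/4 to the contracted variance, while [W] grows by 1. *)
Lemma leaves_var_le n : (1 < n)%N -> var n <= W n.
Proof.
case: n => [|[|n]] // _; elim: n => [|n IH].
  by rewrite leaves_var2 addr_ge0 // ltW.
rewrite leaves_varS // (@total_weightS n.+2) //.
have /andP[_ b] := @branch_var_itv n.+2 isT.
have w1 := @total_weight_gt1 n.+2 isT.
have i0 : 0 < (W n.+2)^-1 by rewrite invr_gt0; lra.
have i1 : (W n.+2)^-1 <= 1 by rewrite invf_le1; lra.
have : (1 - (W n.+2)^-1) ^+ 2 * var n.+2 <= 1 * var n.+2.
  by rewrite ler_wpM2r ?leaves_var_ge0 // expr_le1 //; lra.
lra.
Qed.

(** [W n / 12] solves the variance recursion up to the bias term, and the error contracts by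
    [(w - 2) / w]. From index 3 on [2 < W n], so this factor is positive. *)
Lemma leaves_var_error : exists2 K : R, 0 <= K &
  forall n, (2 < n)%N -> `|var n - W n / 12| <= K / (W n - 1).
Proof.
pose D : R := ((1 - theta) * theta / 2) ^+ 2.
have D0 : 0 <= D by exact: sqr_ge0.
(* The first summand covers the start, the second dominates the bias term of every step. *)
exists (`|var 3 - W 3 / 12| * (W 3 - 1) + D).
  by rewrite addr_ge0 // mulr_ge0 // subr_ge0 ltW // total_weight_gt1.
case => [|[|[|n]]] // _.
set K := _ + D.
elim: n => [|n IH].
  have w1 := @total_weight_gt1 3 isT.
  by rewrite ler_pdivlMr ?subr_gt0 // lerDl.
have w2 : 2 < W n.+3 by rewrite (@total_weightS n.+2) //; have := @total_weight_gt1 n.+2 isT; lra.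
rewrite leaves_varS // branch_varE // leaves_E_leaf_prob_sqr // (@total_weightS n.+3) //.
move: IH w2; move: (var _) (W _) => v w IH w2.
set d := (1 - theta) * theta / 2 / (w - 1).
have -> : (1 - w^-1) ^+ 2 * v + (1 / 4 - (v + d ^+ 2) / w ^+ 2) - (w + 1) / 12 =
  (v - w / 12) * ((w - 2) / w) - D / ((w - 1) ^+ 2 * w ^+ 2).
  by rewrite /d /D; field; apply/andP; split; rewrite gt_eqF //; lra.
apply: le_trans (ler_normB _ _) _.
rewrite normrM (@ger0_norm _ ((w - 2) / w)); last by rewrite divr_ge0 //; lra.
rewrite (@ger0_norm _ (D / _)); last by rewrite divr_ge0 // mulr_ge0 ?sqr_ge0.
rewrite addrK.
apply: (@le_trans _ _ (K / (w - 1) * ((w - 2) / w) + D / ((w - 1) * w))).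
  rewrite lerD //.
    by rewrite ler_wpM2r // divr_ge0 //; lra.
  rewrite ler_wpM2l // lef_pV2 ?posrE ?mulr_gt0 ?exprn_gt0 //; try lra.
  rewrite -exprMn -[leLHS]expr1 ler_weXn2l //.
  have : 0 <= (w - 2) * w by rewrite mulr_ge0 //; lra.
  lra.
have KD : D <= K by rewrite /K lerDr mulr_ge0 // subr_ge0 ltW // total_weight_gt1.
have -> : K / w = K / (w - 1) * ((w - 2) / w) + K / ((w - 1) * w).
  by field; apply/andP; split; rewrite gt_eqF //; lra.
by rewrite lerD2l ler_wpM2r // invr_ge0 mulr_ge0; lra.
Qed.

(** Origin of 1/24: a step adds 1/8 by Hoeffding's lemma, the contraction removes about twice the
    slope and [W] grows by 1, so three times the slope is 1/8. *)
Lemma leaves_mgf n (s : R) : (1 < n)%N ->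
  E n (fun l => expR (s * (l%:R - mean n))) <= expR (s ^+ 2 * ((W n + 2) / 24)).
Proof.
case: n => [|[|n]] // _; elim: n s => [|n IH] s.
  rewrite (leaves_E2 theta_gt0) leaves_mean2 subrr.
  have := @total_weight_gt1 2 isT.
  by rewrite mulr0 ler_expR => w1; rewrite mulr_ge0 ?sqr_ge0 ?divr_ge0 //; lra.
rewrite (leaves_ES_centered (fun x => expR (s * x))) //=.
have w1 := @total_weight_gt1 n.+2 isT.
set a := 1 - _.
apply: (@le_trans _ _ (E n.+2 (fun l => expR (s ^+ 2 / 8) *
    expR (s * a * (l%:R - mean n.+2))))).
  apply: leaves_E_le => // l /(@leaf_prob_itv n.+2 l isT) /andP[p0 p1].
  set p := _ / _ in p0 p1 *; clearbody p a.
  have p01 : 0 <= 1 - p <= 1 by apply/andP; split; lra.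
  (* The upward step [p] has probability [1 - p], hence this parameter. *)
  have h := @hoeffding_bernoulli _ (1 - p) s p01.
  set x := l%:R - _.
  have -> : s * (a * x - (1 - p)) = s * a * x + - (s * (1 - p)) by ring.
  have -> : s * (a * x + p) = s * a * x + s * (1 - (1 - p)) by ring.
  rewrite !expRD; move/(ler_wpM2r (expR_ge0 (s * a * x))): h.
  apply: le_trans; rewrite le_eqVlt; apply/orP; left; apply/eqP; ring.
rewrite leaves_EZ; apply: le_trans (ler_wpM2l (expR_ge0 _) (IH _)) _.
rewrite -expRD ler_expR (@total_weightS n.+2) //.
rewrite exprMn -[s ^+ 2 * a ^+ 2 * _]mulrA -mulrDr ler_wpM2l ?sqr_ge0 // /a.
move: (W _) w1 => w w1.
suff : 0 <= (3 * w - 2) / (24 * w ^+ 2).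
  have -> : (w + 1 + 2) / 24 =
    8^-1 + (1 - w^-1) ^+ 2 * ((w + 2) / 24) + (3 * w - 2) / (24 * w ^+ 2).
    by field; rewrite gt_eqF //; lra.
  lra.
by rewrite divr_ge0 ?mulr_ge0 ?sqr_ge0 //; lra.
Qed.

Lemma leaves_probE n A : leaves_prob theta n A = E n (fun l => (A l)%:R).
Proof.
rewrite /leaves_prob big_mkcond; apply: eq_bigr => s _.
by case: (A _); rewrite ?mulr1 ?mulr0.
Qed.

Lemma leaves_tail (t : R) n : 0 < t -> (0 < n)%N ->
  leaves_prob theta n (fun l => t <= `|l%:R - mean n|)
    <= 2 * expR (- (6 * t ^+ 2 / (n%:R + theta + 1))).
Proof.
move=> t0; case: n => [//|[|n]] _.
  (* With one node the count equals its mean, so the probability is 0. *)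
  rewrite leaves_probE leaves_E1 [mean 1]leaves_E1 subrr normr0.
  by rewrite (lt_geF t0) mulr_ge0 // expR_ge0.
rewrite leaves_probE.
have Wn : n.+2%:R + theta + 1 = W n.+2 + 2 by rewrite /W /= -natr1; ring.
rewrite Wn; have w1 := @total_weight_gt1 n.+2 isT.
set w := W n.+2 in w1 Wn *.
(* The minimiser of [s ^+ 2 * (w + 2) / 24 - s * t]. *)
pose s := 12 * t / (w + 2).
have s0 : 0 < s by rewrite divr_gt0 ?mulr_gt0 //; lra.
(* One exponential for each side of the mean dominates the indicator, whence the factor 2. *)
apply: (@le_trans _ _ (E n.+2 (fun l => expR (- (s * t)) *
   (expR (s * (l%:R - mean n.+2)) + expR (- s * (l%:R - mean n.+2)))))).
  apply: leaves_E_le => // l _.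
  rewrite mulrDr -!expRD.
  have e1 := expR_ge0 (- (s * t) + s * (l%:R - mean n.+2)).
  have e2 := expR_ge0 (- (s * t) + - s * (l%:R - mean n.+2)).
  have [|_] /= := boolP (t <= `|l%:R - mean n.+2|); last by rewrite addr_ge0.
  rewrite ler_normr => /orP[h|h].
    have : 1 <= expR (- (s * t) + s * (l%:R - mean n.+2)); last by move=> /=; lra.
    rewrite -[leLHS]expR0 ler_expR -mulrN -mulrDr.
    by apply: mulr_ge0; [exact: ltW|lra].
  have : 1 <= expR (- (s * t) + - s * (l%:R - mean n.+2)); last by move=> /=; lra.
  rewrite -[leLHS]expR0 ler_expR mulNr -opprD oppr_ge0 -mulrDr.
  by apply: mulr_ge0_le0; [exact: ltW|lra].
rewrite leaves_EZ leaves_ED.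
have h1 := @leaves_mgf n.+2 s isT; have h2 := @leaves_mgf n.+2 (- s) isT.
rewrite sqrrN in h2.
apply: le_trans (ler_wpM2l (expR_ge0 _) (lerD h1 h2)) _.
rewrite -mulr2n mulrnAr -expRD -[X in X <= _]mulr_natl ler_wpM2l // ler_expR.
rewrite le_eqVlt; apply/orP; left; apply/eqP; rewrite -/w /s; field.
rewrite gt_eqF //; lra.
Qed.

End Moments.

(** * Central limit theorem *)

Section SmoothedCLT.
Variables (R : realType) (theta : R).
Hypothesis theta_gt0 : 0 < theta.

Local Notation E := (leaves_E theta).
Local Notation mean := (leaves_mean theta).
Local Notation var := (leaves_var theta).
Local Notation W := (total_weight theta).
Local Notation q := (branch_var theta).
Let W1 n := @total_weight_gt1 R theta theta_gt0 n.

(** * Asymptotics of mean and variance in terms of [n] *)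

Lemma total_weightE n : (0 < n)%N -> W n = n%:R + theta - 1.
Proof. by case: n => // n _; rewrite /total_weight /= -natr1; ring. Qed.

(** [W n - 1 = n + theta - 2] is at least [n / 3] once [n] is at least 3. *)
Lemma div_total_weight_le (K : R) n : 0 <= K -> (2 < n)%N ->
  K / (W n - 1) <= 3 * K / n%:R.
Proof.
move=> K0 n2.
have n3 : 3%:R <= n%:R :> R by rewrite ler_nat.
have t0 := theta_gt0.
rewrite total_weightE; last lia.
rewrite mulrAC mulrC ler_wpM2r // -[leLHS]mul1r ler_pdivrMr; last lra.
rewrite mulrAC ler_pdivlMr; lra.
Qed.

Lemma leaves_mean_asymptotic n : (2 < n)%N ->
  `|mean n - (n%:R / 2 + (theta - 1) / 2)|
    <= 3 * `|(1 - theta) * theta / 2| / n%:R.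
Proof.
move=> n2; apply: le_trans (div_total_weight_le (normr_ge0 _) n2).
have n1 : (1 < n)%N by lia.
have w1 := W1 n1.
rewrite leaves_meanE // {1}total_weightE; last lia.
have -> : (n%:R + theta - 1) / 2 = n%:R / 2 + (theta - 1) / 2 by field.
rewrite addrAC subrr add0r normrM (@ger0_norm _ (_^-1)) //.
by rewrite invr_ge0; lra.
Qed.

Lemma leaves_var_asymptotic : exists2 C : R, 0 <= C & forall n, (2 < n)%N ->
  `|var n - (n%:R / 12 + (theta - 1) / 12)| <= C / n%:R.
Proof.
have [K K0 HK] := leaves_var_error theta_gt0.
exists (3 * K); first by rewrite mulr_ge0.
move=> n n2; apply: le_trans (div_total_weight_le K0 n2).
have -> : n%:R / 12 + (theta - 1) / 12 = W n / 12.
  by rewrite total_weightE; [field|lia].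
exact: HK.
Qed.

Lemma leaves_var_lower : exists N : nat, forall n, (N <= n)%N ->
  n%:R / 24 <= var n.
Proof.
have [C C0 HC] := leaves_var_asymptotic.
(* From [24 * C + 2] on, half of the leading term [n / 12] absorbs the error [C] and a constant term
   of at least [-1 / 12]. *)
exists (Num.bound (24 * C + 2) + 3)%N => n Nn.
have nB : 24 * C + 2 <= n%:R.
  apply: le_trans (ltW (archi_boundP _)) _; first by lra.
  by rewrite ler_nat; lia.
have n1 : 1 <= n%:R :> R by rewrite ler1n; lia.
have n2 : (2 < n)%N by lia.
have := HC n n2; rewrite ler_norml => /andP[+ _].
have : C / n%:R <= C by rewrite ler_pdivrMr; [rewrite ler_peMr|lra].
have := theta_gt0; lra.
Qed.

(** The centred count times [W k - 1] is a martingale, so its second moment increases. *)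
Lemma martingale_var_le k n : (1 < k)%N -> (k <= n)%N ->
  (W k - 1) ^+ 2 * var k <= (W n - 1) ^+ 2 * var n.
Proof.
move=> k1; elim: n => [|n IH]; first by lia.
rewrite leq_eqVlt => /orP[/eqP -> //|]; rewrite ltnS => kn.
apply: le_trans (IH kn) _.
have n1 : (1 < n)%N by lia.
have w1 := W1 n1.
have /andP[q0 _] := branch_var_itv theta_gt0 n1.
rewrite leaves_varS // total_weightS ?addrK; last lia.
have -> : W n ^+ 2 * ((1 - (W n)^-1) ^+ 2 * var n + q n) =
   (W n - 1) ^+ 2 * var n + W n ^+ 2 * q n.
  by field; rewrite gt_eqF //; lra.
by rewrite lerDl mulr_ge0 ?sqr_ge0.
Qed.

(** The variance is at most [W n] and the bias is bounded; both are divided by [W n ^+ 2]. *)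
Lemma leaf_prob_sqr_le n : (1 < n)%N ->
  E n (fun l => (l%:R / W n - 1 / 2) ^+ 2) <= (1 + (1 - theta) ^+ 2) / W n.
Proof.
move=> n1; rewrite leaves_E_leaf_prob_sqr //.
have w1 := W1 n1; have vw := leaves_var_le theta_gt0 n1.
have t0 := theta_gt0.
have tw : theta <= W n - 1.
  rewrite total_weightE; last lia.
  by have : 2%:R <= n%:R :> R; [rewrite ler_nat|lra].
have d : ((1 - theta) * theta / 2 / (W n - 1)) ^+ 2 <= (1 - theta) ^+ 2.
  have -> : (1 - theta) * theta / 2 / (W n - 1) =
    (1 - theta) * (theta / 2 / (W n - 1)) by ring.
  rewrite exprMn ler_piMr ?sqr_ge0 // expr_le1 //.
    by rewrite ler_pdivrMr; lra.
  by rewrite !divr_ge0 //; lra.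
rewrite ler_pdivrMr ?exprn_gt0; try lra.
have -> : (1 + (1 - theta) ^+ 2) / W n * W n ^+ 2 = (1 + (1 - theta) ^+ 2) * W n.
  by field; rewrite gt_eqF //; lra.
have : (1 - theta) ^+ 2 * 1 <= (1 - theta) ^+ 2 * W n.
  by rewrite ler_wpM2l ?sqr_ge0 ?ltW.
lra.
Qed.

(** The deviation is that of [(p - 1 / 2) ^+ 2] from its mean, hence at most twice this mean on
    average. It permits replacing the random step variance by [q n]. *)
Lemma branch_var_dev n : (1 < n)%N ->
  E n (fun l => `|l%:R / W n * (1 - l%:R / W n) - q n|)
    <= 2 * ((1 + (1 - theta) ^+ 2) / W n).
Proof.
move=> n1; have Q := leaf_prob_sqr_le n1.
set Q1 := E n _ in Q.
apply: (@le_trans _ _ (E n (fun l => (l%:R / W n - 1 / 2) ^+ 2 + Q1))).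
  apply: leaves_E_le => // l _; rewrite branch_varE // -/Q1.
  have Q0 : 0 <= Q1.
    rewrite -(@leaves_E_cst _ _ theta_gt0 n 0); last lia.
    by apply: leaves_E_le => // i _; exact: sqr_ge0.
  have := sqr_ge0 (l%:R / W n - 1 / 2); clearbody Q1.
  move: (l%:R / _) => p p0.
  by rewrite ler_norml; apply/andP; split; lra.
rewrite leaves_ED leaves_E_cst //; last lia.
by rewrite -/Q1; clearbody Q1; lra.
Qed.

Section Lindeberg.
Variables (n : nat) (x eps : R).
Hypotheses (n_gt1 : (1 < n)%N) (eps_gt0 : 0 < eps) (var_gt0 : 0 < var n).

(* [mg_scale k * (L_k - E L_k)] is a martingale ending at [L_n - E L_n]. *)
Definition mg_scale k : R := (W k - 1) / (W n - 1).
(** The term with [eps] keeps the remaining time positive up to the last step. *)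
Definition time_left k : R := (1 + eps ^+ 2) * var n - mg_scale k ^+ 2 * var k.
(** At [k = n] this is a smoothed indicator of [y <= x * Num.sqrt (var n)]; at [k = 2] the centred
    count is 0 and the value is a constant close to [normal_cdf x] for small [eps]. *)
Definition heat k (y : R) : R :=
  normal_cdf ((x * Num.sqrt (var n) - mg_scale k * y) / Num.sqrt (time_left k)).

Lemma mg_scale_le1 k : (k <= n)%N -> (1 < k)%N -> 0 <= mg_scale k <= 1.
Proof.
move=> kn k1; have wn := W1 n_gt1; have wk := W1 k1.
rewrite /mg_scale divr_ge0 /=; try lra.
rewrite ler_pdivrMr ?mul1r ?lerD2r; try lra.
by rewrite ler_nat; lia.
Qed.

Lemma time_left_ge k : (k <= n)%N -> (1 < k)%N -> eps ^+ 2 * var n <= time_left k.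
Proof.
move=> kn k1; have wn := W1 n_gt1.
have := martingale_var_le k1 kn; rewrite /time_left /mg_scale => h.
have w0 : 0 < (W n - 1) ^+ 2 by rewrite exprn_gt0 //; lra.
rewrite mulrDl mul1r [leRHS]addrAC lerDr subr_ge0.
by rewrite expr_div_n mulrAC ler_pdivrMr // [leRHS]mulrC.
Qed.

Lemma mg_scaleS k : (1 < k)%N -> mg_scale k.+1 * (1 - (W k)^-1) = mg_scale k.
Proof.
move=> k1; have wn := W1 n_gt1; have wk := W1 k1.
rewrite /mg_scale total_weightS; last lia.
by field; apply/andP; split; rewrite gt_eqF //; lra.
Qed.

(** Time drops by exactly the mean variance of the scaled step, which matches the second-order terms
    in [heat_step]. *)
Lemma time_leftS k : (1 < k)%N ->
  time_left k = time_left k.+1 + mg_scale k.+1 ^+ 2 * q k.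
Proof.
move=> k1; rewrite /time_left leaves_varS // -(mg_scaleS k1).
ring.
Qed.

(** [r] bounds the scaled step relative to the square root of the time left. Powers 3 and 4 come
    from the expansions, the last term from averaging the step variance. *)
Definition lindeberg_err : R :=
  let r := (eps * Num.sqrt (var n))^-1 in
  16 * (r ^+ 3 + r ^+ 4 + (1 + (1 - theta) ^+ 2) * r ^+ 2 / (W n - 1)).

Lemma heat_step k : (1 < k)%N -> (k < n)%N ->
  `|E k.+1 (fun l => heat k.+1 (l%:R - mean k.+1)) -
    E k (fun l => heat k (l%:R - mean k))| <= lindeberg_err.
Proof.
move=> k1 kn; rewrite leaves_ES_centered //=.
have wn := W1 n_gt1; have wk := W1 k1.
have kn' : (k.+1 <= n)%N by [].
have k1' : (1 < k.+1)%N by lia.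
have /andP[b0 b1] := mg_scale_le1 kn' k1'.
have tl := time_left_ge kn' k1'.
have ev0 : 0 < eps ^+ 2 * var n by rewrite mulr_gt0 ?exprn_gt0.
have t0 : 0 < time_left k.+1 by exact: lt_le_trans tl.
have s0 : 0 < Num.sqrt (time_left k.+1) by rewrite sqrtr_gt0.
have /andP[q0 q1] := branch_var_itv theta_gt0 k1.
set b := mg_scale k.+1 in b0 b1 *.
pose beta := b / Num.sqrt (time_left k.+1).
have beta0 : 0 <= beta by rewrite divr_ge0 // ltW.
have beta2 : beta ^+ 2 = b ^+ 2 / time_left k.+1.
  by rewrite expr_div_n sqr_sqrtr // ltW.
have q01 : 0 <= q k <= 1 by apply/andP; split; lra.
set r := (eps * Num.sqrt (var n))^-1.
have r0 : 0 <= r by rewrite invr_ge0 mulr_ge0 ?sqrtr_ge0 ?ltW.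
have r2 : r ^+ 2 = (eps ^+ 2 * var n)^-1.
  by rewrite exprVn exprMn sqr_sqrtr // ltW.
have tr : (time_left k.+1)^-1 <= r ^+ 2 by rewrite r2 lef_pV2 ?posrE.
have br : beta <= r.
  rewrite -(@ler_pXn2r _ 2) ?nnegrE // beta2 -[leRHS]mul1r ler_pM ?sqr_ge0 //.
    by rewrite invr_ge0 ltW.
  by rewrite expr_le1.
pose D : R := 1 + (1 - theta) ^+ 2.
have D0 : 0 <= D by rewrite addr_ge0 ?sqr_ge0.
have bdev : beta ^+ 2 * (2 * (D / W k)) <= 2 * (D * r ^+ 2 / (W n - 1)).
  (* As [b = W k / (W n - 1)], the factor [W k] cancels and the bound no longer depends on [k]. *)
  have bw : b ^+ 2 / W k <= (W n - 1)^-1.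
    have bE : b = W k / (W n - 1).
      by rewrite /b /mg_scale total_weightS ?addrK //; lia.
    have -> : b ^+ 2 / W k = b * (W n - 1)^-1.
      by rewrite bE; field; apply/andP; split; rewrite gt_eqF //; lra.
    by rewrite ler_piMl // invr_ge0; lra.
  have -> : beta ^+ 2 * (2 * (D / W k)) =
    2 * D * ((b ^+ 2 / W k) * (time_left k.+1)^-1) by rewrite beta2; ring.
  have -> : 2 * (D * r ^+ 2 / (W n - 1)) = 2 * D * ((W n - 1)^-1 * r ^+ 2) by ring.
  rewrite ler_wpM2l ?mulr_ge0 // ler_pM //.
    by rewrite divr_ge0 ?sqr_ge0 //; lra.
  by rewrite invr_ge0 ltW.
rewrite -[X in _ - X]mul1r -mulNr -leaves_EZ -leaves_ED.
pose dev l := `|l%:R / W k * (1 - l%:R / W k) - q k|.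
apply: (@le_trans _ _ (E k (fun l => 8 * beta ^+ 2 * dev l +
    16 * (beta ^+ 3 + beta ^+ 4)))); last first.
  rewrite (leaves_E_affine theta_gt0 _ _ dev (ltnW k1)).
  have b3 : beta ^+ 3 <= r ^+ 3 by rewrite lerXn2r ?nnegrE.
  have b4 : beta ^+ 4 <= r ^+ 4 by rewrite lerXn2r ?nnegrE.
  have h : beta ^+ 2 * E k dev <= 2 * (D * r ^+ 2 / (W n - 1)).
    apply: le_trans bdev.
    by apply: ler_wpM2l (sqr_ge0 beta) _ _ (branch_var_dev k1).
  rewrite /lindeberg_err -/r -/D.
  move: (E k _) (D * r ^+ 2 / (W n - 1)) h => e1 e2 h.
  lra.
have pw l : (l <= k.-1)%N ->
  `|l%:R / W k * heat k.+1 ((1 - (W k)^-1) * (l%:R - mean k) - (1 - l%:R / W k)) +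
    (1 - l%:R / W k) * heat k.+1 ((1 - (W k)^-1) * (l%:R - mean k) + l%:R / W k) -
    heat k (l%:R - mean k)| <=
  8 * beta ^+ 2 * dev l + 16 * (beta ^+ 3 + beta ^+ 4).
  move=> /(leaf_prob_itv theta_gt0 k1) p01.
  set z := (x * Num.sqrt (var n) - mg_scale k * (l%:R - mean k)) /
    Num.sqrt (time_left k.+1).
  have := normal_cdf_step z p01 beta0 q01.
  set p := l%:R / W k.
  have -> : heat k.+1 ((1 - (W k)^-1) * (l%:R - mean k) - (1 - p)) =
      normal_cdf (z + beta * (1 - p)).
    rewrite /heat /z /beta -/b -(mg_scaleS k1) -/b; congr normal_cdf; ring.
  have -> : heat k.+1 ((1 - (W k)^-1) * (l%:R - mean k) + p) =
      normal_cdf (z - beta * p).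
    rewrite /heat /z /beta -/b -(mg_scaleS k1) -/b; congr normal_cdf; ring.
  (* By [time_leftS], [time_left k / time_left k.+1] equals [1 + beta ^+ 2 * q k]. *)
  have -> : heat k (l%:R - mean k) =
      normal_cdf (z / Num.sqrt (1 + beta ^+ 2 * q k)).
    rewrite /heat /z; congr normal_cdf.
    rewrite -[RHS]mulrA -invfM -sqrtrM; last exact: ltW.
    congr (_ / Num.sqrt _); rewrite (time_leftS k1) beta2 -/b.
    by field; rewrite gt_eqF.
  by rewrite [leRHS]addrC -[8 * _ * dev l]mulrA.
rewrite ler_norml; apply/andP; split.
  rewrite -[- E _ _]mulN1r -leaves_EZ; apply: leaves_E_le => // l lk.
  by have := pw l lk; rewrite ler_norml => /andP[+ _]; rewrite mulN1r mulN1r.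
apply: leaves_E_le => // l lk.
by have := pw l lk; rewrite ler_norml mulN1r => /andP[_].
Qed.

(** Telescoping of [heat_step] from the deterministic count at [k = 2] up to [k = n], in fewer than
    [n] steps. *)
Lemma smoothed_clt :
  `|E n (fun l => normal_cdf ((x * Num.sqrt (var n) - (l%:R - mean n)) /
      (eps * Num.sqrt (var n)))) - normal_cdf (x / Num.sqrt (1 + eps ^+ 2))|
  <= n%:R * lindeberg_err.
Proof.
have wn := W1 n_gt1.
have chain k : (k + 2 <= n)%N ->
  `|E (k + 2) (fun l => heat (k + 2) (l%:R - mean (k + 2))) -
    normal_cdf (x / Num.sqrt (1 + eps ^+ 2))| <= k%:R * lindeberg_err.
  elim: k => [|k IH] kn.
    rewrite add0n (leaves_E2 theta_gt0) leaves_mean2 // subrr.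
    rewrite /heat /time_left leaves_var2 // !mulr0 !subr0.
    rewrite sqrtrM ?addr_ge0 ?sqr_ge0 // -mulf_div.
    rewrite divff; last by rewrite gt_eqF // sqrtr_gt0.
    by rewrite mulr1 subrr normr0 mul0r.
  rewrite -natr1 mulrDl mul1r addSn.
  have k2 : (1 < k + 2)%N by lia.
  have := heat_step k2 kn; have := IH (ltnW kn).
  move: (E _ _) (E _ _) (normal_cdf _) => e2 e1 e3 h1 h2.
  have -> : e2 - e3 = (e1 - e3) + (e2 - e1) by ring.
  exact: le_trans (ler_normD _ _) (lerD h1 h2).
have [n2 nn] : ((n - 2) + 2 = n)%N /\ ((n - 2) <= n)%N by lia.
have := chain (n - 2)%N; rewrite n2 => /(_ (leqnn _)).
have -> : (fun l : nat => heat n (l%:R - mean n)) =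
  (fun l => normal_cdf ((x * Num.sqrt (var n) - (l%:R - mean n)) /
      (eps * Num.sqrt (var n)))).
  apply/funext => l; rewrite /heat /mg_scale /time_left /mg_scale.
  rewrite divff ?mul1r ?expr1n ?mul1r; last by rewrite gt_eqF //; lra.
  rewrite (_ : (1 + eps ^+ 2) * var n - var n = eps ^+ 2 * var n); last ring.
  by rewrite sqrtrM ?sqr_ge0 // sqrtr_sqr gtr0_norm.
move/le_trans; apply; rewrite ler_wpM2r ?ler_nat //.
have r0 : 0 <= (eps * Num.sqrt (var n))^-1.
  by rewrite invr_ge0 mulr_ge0 ?sqrtr_ge0 ?ltW.
rewrite /lindeberg_err mulr_ge0 // addr_ge0 ?addr_ge0 ?exprn_ge0 // divr_ge0 //.
  by rewrite mulr_ge0 ?addr_ge0 ?sqr_ge0 ?exprn_ge0.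
by rewrite subr_ge0 ltW.
Qed.

End Lindeberg.
End SmoothedCLT.

Section CLT.
Variables (R : realType) (theta : R).
Hypothesis theta_gt0 : 0 < theta.

Local Notation E := (leaves_E theta).
Local Notation mean := (leaves_mean theta).
Local Notation var := (leaves_var theta).

(* The error is [n] times [O(r^3 + r^2 / n)] where [r = 1 / (eps sqrt (var n))]
   is of order [1 / sqrt n]. *)
Lemma lindeberg_err_le (eps : R) : 0 < eps -> exists2 K : R, 0 <= K &
  exists N : nat, forall n, (N <= n)%N ->
    n%:R * lindeberg_err theta n eps <= K / Num.sqrt n%:R.
Proof.
move=> e0; have [N0 HN] := leaves_var_lower theta_gt0.
(* By [leaves_var_lower], [r ^+ 2] is at most [a / n]. *)
pose a : R := 24 / eps ^+ 2.
pose D : R := 1 + (1 - theta) ^+ 2.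
have a0 : 0 <= a by rewrite divr_ge0 ?sqr_ge0.
have D0 : 0 <= D by rewrite addr_ge0 ?sqr_ge0.
exists (16 * (a * Num.sqrt a + a ^+ 2 + 3 * D * a)).
  have h1 : 0 <= a * Num.sqrt a by exact: mulr_ge0 (sqrtr_ge0 a).
  have h2 : 0 <= 3 * D * a by exact: mulr_ge0 (mulr_ge0 (ler0n R 3) D0) a0.
  by have := sqr_ge0 a; lra.
exists (N0 + 3)%N => n Nn.
have n2 : (2 < n)%N by lia.
have n0 : 0 < n%:R :> R by rewrite ltr0n; lia.
have n1 : 1 <= n%:R :> R by rewrite ler1n; lia.
have vn : n%:R / 24 <= var n by apply: HN; lia.
have v0 : 0 < var n by apply: lt_le_trans vn; rewrite divr_gt0.
rewrite /lindeberg_err; set r := (eps * _)^-1.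
have r0 : 0 <= r by rewrite invr_ge0 mulr_ge0 ?sqrtr_ge0 ?ltW.
set s := Num.sqrt n%:R.
have s1 : 1 <= s by rewrite -sqrtr1 ler_sqrt.
have ss : s ^+ 2 = n%:R by rewrite sqr_sqrtr ?ltW.
have s0 : 0 < s by lra.
have r2 : r ^+ 2 <= a / n%:R.
  rewrite exprVn exprMn sqr_sqrtr; last exact: ltW.
  rewrite /a.
  have -> : 24 / eps ^+ 2 / n%:R = (eps ^+ 2 * (n%:R / 24))^-1.
    by field; apply/andP; split; rewrite gt_eqF.
  by rewrite lef_pV2 ?posrE ?mulr_gt0 ?divr_gt0 ?exprn_gt0 // ler_wpM2l ?sqr_ge0.
have rs : r <= Num.sqrt a / s.
  rewrite -(@ler_pXn2r _ 2) ?nnegrE ?divr_ge0 ?sqrtr_ge0 //.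
  by rewrite expr_div_n sqr_sqrtr // ss.
have w := @div_total_weight_le _ _ theta_gt0 D n D0 n2.
have i1 : n%:R^-1 = s^-1 * s^-1 by rewrite -ss expr2 invfM.
have is0 : 0 < s^-1 by rewrite invr_gt0.
have is1 : s^-1 <= 1 by rewrite invf_le1.
have nr2 : n%:R * r ^+ 2 <= a by rewrite -ler_pdivlMl // mulrC.
have nr0 : 0 <= n%:R * r ^+ 2 by rewrite mulr_ge0 ?sqr_ge0 ?ltW.
have b3 : n%:R * r ^+ 3 <= a * (Num.sqrt a / s).
  by rewrite exprSr mulrA ler_pM.
have b4 : n%:R * r ^+ 4 <= a ^+ 2 / s.
  rewrite (_ : n%:R * r ^+ 4 = n%:R * r ^+ 2 * r ^+ 2); last ring.
  rewrite (_ : a ^+ 2 / s = a * (a / s)); last ring.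
  rewrite ler_pM ?sqr_ge0 // (le_trans r2) // ler_wpM2l // i1.
  by rewrite ler_piMl // ltW.
have b5 : n%:R * (D * r ^+ 2 / (total_weight theta n - 1)) <= 3 * D * a / s.
  rewrite (_ : n%:R * _ = n%:R * r ^+ 2 * (D / (total_weight theta n - 1))); last ring.
  rewrite (_ : 3 * D * a / s = a * (3 * D / s)); last ring.
  rewrite ler_pM //.
    have := total_weight_gt1 theta_gt0 (ltnW n2).
    by move=> ?; rewrite divr_ge0 //; lra.
  rewrite (le_trans w) // ler_wpM2l ?mulr_ge0 // i1.
  by rewrite ler_piMl // ltW.
rewrite -/D.
rewrite [leRHS](_ : _ = 16 * (a * (Num.sqrt a / s) + a ^+ 2 / s + 3 * D * a / s)); last ring.
by rewrite mulrCA ler_wpM2l // mulrDr [n%:R * (_ + _)]mulrDr !lerD.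
Qed.

(** Removes the smoothing: by the Lipschitz bound a small shift [d] and a scale [s] near 1 cost
    little. *)
Lemma cdf_shift_le (x d s : R) : 1 <= s ->
  `|normal_cdf ((x + d) / s) - normal_cdf x| <= `|d| + `|x| * (s - 1).
Proof.
move=> s1; apply: le_trans (normal_cdf_lip _ _) _.
have s0 : 0 < s by lra.
have -> : (x + d) / s - x = (d - x * (s - 1)) / s by field; rewrite gt_eqF.
rewrite normrM (@ger0_norm _ (s^-1)); last by rewrite invr_ge0 ltW.
rewrite ler_pdivrMr //.
apply: le_trans (ler_normB _ _) _.
rewrite normrM (@ger0_norm _ (s - 1)) ?subr_ge0 //.
by rewrite ler_peMr // addr_ge0 // mulr_ge0 // subr_ge0.
Qed.

(** Up to [e / 4], the indicator lies between its smoothed versions at [x - eps * M] and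
    [x + eps * M]. The shift and the smoothed limit cost another [e / 4] each. *)
Lemma leaves_clt (x : R) :
  (fun n : nat => (leaves_prob theta n
      (fun l => ((l%:R - mean n) / Num.sqrt (var n) <= x)))%:E)
    @ \oo --> normal_prob 0 1 `]-oo, x].
Proof.
rewrite -normal_cdfE; apply: cvg_EFin; first by apply: nearW.
apply/cvgrPdist_le => /= e e0.
have e40 : 0 < e / 4 by rewrite divr_gt0.
have [M M0 [Mlo Mhi]] := normal_cdf_tails e40.
pose eps := Num.min 1 (e / 4 / (M + `|x| + 1)).
have B0 : 0 < M + `|x| + 1 by have := normr_ge0 x; lra.
have eps0 : 0 < eps by rewrite lt_min ltr01 divr_gt0.
have eps1 : eps <= 1 by rewrite ge_min lexx.
have epsB : eps * (M + `|x|) <= e / 4.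
  apply: (@le_trans _ _ (eps * (M + `|x| + 1))).
    by rewrite ler_wpM2l ?lerDl // ltW.
  by rewrite -ler_pdivlMr // ge_min lexx orbT.
pose s := Num.sqrt (1 + eps ^+ 2).
have s1 : 1 <= s by rewrite -sqrtr1 ler_sqrt ?lerDl ?sqr_ge0 // addr_ge0 ?sqr_ge0.
(* Compare [s ^+ 2 = 1 + eps ^+ 2] with [(1 + eps) ^+ 2]. *)
have s2 : s - 1 <= eps.
  have ss : s ^+ 2 = 1 + eps ^+ 2 by rewrite sqr_sqrtr // addr_ge0 ?sqr_ge0.
  clearbody s eps; rewrite lerBlDl -(@ler_pXn2r _ 2) ?nnegrE ?ss //; lra.
have shift d : `|d| = eps * M -> `|normal_cdf ((x + d) / s) - normal_cdf x| <= e / 4.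
  move=> dE; apply: le_trans (cdf_shift_le x d s1) _; rewrite dE.
  apply: le_trans epsB; rewrite [eps * (M + _)]mulrDr lerD2l mulrC ler_wpM2r //.
have [N0 HN0] := leaves_var_lower theta_gt0.
have [K K0 [N1 HN1]] := lindeberg_err_le eps0.
pose N2 := Num.bound ((K / (e / 4)) ^+ 2).
near=> n.
have n1 : (1 < n)%N by near: n; exact: nbhs_infty_gt.
have N0n : (N0 <= n)%N by near: n; exact: nbhs_infty_ge.
have N1n : (N1 <= n)%N by near: n; exact: nbhs_infty_ge.
have N2n : (N2 <= n)%N by near: n; exact: nbhs_infty_ge.
have n0 : 0 < n%:R :> R by rewrite ltr0n ltnW.
have v0 : 0 < var n.
  by apply: lt_le_trans (HN0 n N0n); rewrite divr_gt0.
have Kn : K / Num.sqrt n%:R <= e / 4.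
  rewrite ler_pdivrMr ?sqrtr_gt0 // -ler_pdivrMl // mulrC.

  rewrite -(@ler_pXn2r _ 2) ?nnegrE ?sqrtr_ge0 ?divr_ge0 ?(ltW e0) //.
  rewrite sqr_sqrtr //.
  apply: le_trans (ltW (archi_boundP (sqr_ge0 _))) _.
  by rewrite ler_nat.
have err : n%:R * lindeberg_err theta n eps <= e / 4.
  exact: le_trans (HN1 n N1n) Kn.
have sv : 0 < Num.sqrt (var n) by rewrite sqrtr_gt0.
have arg (y : R) (l : nat) : (y * Num.sqrt (var n) - (l%:R - mean n)) / (eps * Num.sqrt (var n)) =
    (y - (l%:R - mean n) / Num.sqrt (var n)) / eps.
  by field; apply/andP; split; rewrite gt_eqF.
pose A (l : nat) := (l%:R - mean n) / Num.sqrt (var n) <= x.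
rewrite leaves_probE -/A ler_distlC; apply/andP; split.
  have h1 := le_trans (smoothed_clt theta_gt0 (x - eps * M) n1 eps0 v0) err.
  have h2 : `|normal_cdf ((x - eps * M) / s) - normal_cdf x| <= e / 4.
    by apply: shift; rewrite normrN ger0_norm // mulr_ge0 // ltW.
  set S := E n _ in h1.
  have h3 : S + - (e / 4) <= E n (fun l => (A l)%:R).
    rewrite /S -(@leaves_E_cst _ _ theta_gt0 n (- (e / 4))) -?leaves_ED; last exact: ltnW.
    apply: leaves_E_le => // l _; rewrite arg /A.
    (* For [y > x] the argument lies below [- M], where [normal_cdf] is at most [e / 4]. *)
    set y := _ / Num.sqrt _; have [yx|xy] := leP y x.
      by have := normal_cdf_le1 ((x - eps * M - y) / eps); rewrite mulr1n; lra.
    have : normal_cdf ((x - eps * M - y) / eps) <= normal_cdf (- M).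
      apply: normal_cdf_le; rewrite ler_pdivrMr // mulNr [M * _]mulrC; lra.
    rewrite mulr0n; lra.
  move: h1 h2; rewrite -/s !ler_norml => /andP[h1 _] /andP[h2 _]; lra.
have h1 := le_trans (smoothed_clt theta_gt0 (x + eps * M) n1 eps0 v0) err.
have h2 : `|normal_cdf ((x + eps * M) / s) - normal_cdf x| <= e / 4.
  by apply: shift; rewrite ger0_norm // mulr_ge0 // ltW.
set S := E n _ in h1.
have h3 : E n (fun l => (A l)%:R) <= S + e / 4.
  rewrite /S -(@leaves_E_cst _ _ theta_gt0 n (e / 4)) -?leaves_ED; last exact: ltnW.
  apply: leaves_E_le => // l _; rewrite arg /A.
  (* For [y <= x] the argument is at least [M], where [normal_cdf] is at least [1 - e / 4]. *)
  set y := _ / Num.sqrt _; have [yx|xy] := leP y x.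
    have : normal_cdf M <= normal_cdf ((x + eps * M - y) / eps).
      apply: normal_cdf_le; rewrite ler_pdivlMr // [M * _]mulrC; lra.
    rewrite mulr1n; lra.
  by have := normal_cdf_ge0 ((x + eps * M - y) / eps); rewrite mulr0n; lra.
move: h1 h2; rewrite -/s !ler_norml => /andP[_ h1] /andP[_ h2]; lra.
Unshelve. all: by end_near. Qed.

End CLT.

Theorem theorem2p5 (R : realType) (theta : R) (htheta : 0 < theta) :
  (exists C : R, exists N : nat, forall n : nat, (N <= n)%N ->
      `|leaves_mean theta n - (n%:R / 2 + (theta - 1) / 2)| <= C / n%:R) /\
  (exists C : R, exists N : nat, forall n : nat, (N <= n)%N ->
      `|leaves_var theta n - (n%:R / 12 + (theta - 1) / 12)| <= C / n%:R) /\
  (forall x : R,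
      (fun n : nat => (leaves_prob theta n
          (fun l => ((l%:R - leaves_mean theta n) / Num.sqrt (leaves_var theta n)
                     <= x)))%:E)
        @ \oo --> normal_prob 0 1 `]-oo, x]) /\
  (forall (t : R) (n : nat), 0 < t -> (1 <= n)%N ->
      leaves_prob theta n (fun l => t <= `|l%:R - leaves_mean theta n|)
        <= 2 * expR (- (6 * t ^+ 2 / (n%:R + theta + 1)))).
Proof.
split; [|split; [|split]].
- exists (3 * `|(1 - theta) * theta / 2|), 3%N => n n2.
  exact: leaves_mean_asymptotic.
- by have [C _ HC] := leaves_var_asymptotic htheta; exists C, 3%N.
- exact: leaves_clt.
- by move=> t n; exact: leaves_tail.
Qed.
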